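(* Let $U=\{u_1,\dots,u_n\}\subset\mathbb R^m$ with $m\ge n$, and let $u\in\mathbb R^m$ with $|\angle(u,U)|>0$. Suppose the orthogonal projection of $u$ onto the affine span $\mathrm{aff}\,U$ lies in the interior (relative to $\mathrm{aff}\,U$) of the convex hull of $U$. Let $v\in\mathbb R^m$ satisfy $(u-v,u-u_i)=0$ for every $i$. If $u\neq v$, then $|\angle(u,U)|>|\angle(v,U)|$.
   Context: For a point $u$ and $U=\{u_1,\dots,u_n\}$ in a Euclidean space, the angle $\angle(u,U)$ is the cone $\{\sum_{i=1}^n\alpha_i(u_i-u):\alpha_i\ge0\}$, and its norm $|\angle(u,U)|$ is the $n$-dimensional volume of the intersection of $\angle(u,U)$ with the closed unit ball centered at the origin. $\mathrm{aff}\,U=\{\sum_i\alpha_iu_i:\sum_i\alpha_i=1\}$.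
   Formalization: The formal theorem assumes n ≥ 2: for n = 1 the strict inequality fails (both angles are rays of norm 1, e.g. u=(0,0), u_1=(1,0), v=(0,1)), and for n = 0 the projection onto aff U does not exist. *)

(* Defs.v *)
From HB Require Import structures.
From mathcomp Require Import all_boot all_order all_algebra.
From mathcomp Require Import all_classical all_reals all_analysis.
Set Implicit Arguments.
Unset Strict Implicit.
Unset Printing Implicit Defensive.
Import Order.TTheory GRing.Theory Num.Theory.
Import numFieldNormedType.Exports.
Local Open Scope classical_set_scope.
Local Open Scope ring_scope.

Section lebesgue_tuple.
Variable R : realType.
Local Notation T := (measurableTypeR R).

Definition tcons n (p : T * n.-tuple T) : n.+1.-tuple T :=
  [tuple of p.1 :: p.2].

Definition tuncons n (t : n.+1.-tuple T) : T * n.-tuple T :=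
  (thead t, [tuple of behead t]).

Lemma tconsK n : cancel (@tcons n) (@tuncons n).
Proof.
by move=> [x t]; rewrite /tuncons /tcons /=; congr (_, _); exact: val_inj.
Qed.

Lemma measurable_tcons n : measurable_fun [set: T * n.-tuple T] (@tcons n).
Proof. by apply: measurable_cons. Qed.

Lemma measurable_tuncons n : measurable_fun [set: n.+1.-tuple T] (@tuncons n).
Proof.
apply/measurable_fun_pairP; split.
  exact: measurable_tnth.
exact: measurable_behead.
Qed.

Section cons_measure.
Local Open Scope ereal_scope.
Variables (n : nat) (mu : {sigma_finite_measure set (n.-tuple T) -> \bar R}).

Definition cons_measure : set (n.+1.-tuple T) -> \bar R :=
  pushforward (lebesgue_measure \x mu) (@tcons n).

Let cons_measure0 : cons_measure set0 = 0.
Proof. by rewrite /cons_measure /pushforward preimage_set0 measure0. Qed.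

Let cons_measure_ge0 A : 0 <= cons_measure A.
Proof. by rewrite /cons_measure /pushforward; apply: measure_ge0. Qed.

Let cons_measure_sigma_additive : semi_sigma_additive cons_measure.
Proof.
move=> F mF tF mUF; rewrite /cons_measure /pushforward preimage_bigcup.
apply: measure_semi_sigma_additive.
- by move=> k; rewrite -[X in measurable X]setTI; exact: measurable_tcons.
- apply/trivIsetP => /= i j _ _ ij; rewrite -preimage_setI.
  by move/trivIsetP : tF => /(_ _ _ _ _ ij) ->//; rewrite preimage_set0.
- by rewrite -preimage_bigcup -[X in measurable X]setTI; exact: measurable_tcons.
Qed.

HB.instance Definition _ := isMeasure.Build _ _ _ cons_measure
  cons_measure0 cons_measure_ge0 cons_measure_sigma_additive.

(* Not inferred: the sigma-finite instance of \x is shadowed in the library by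
   the one for products of subprobabilities. *)
Let cons_measure_sigma_finite : sigma_finite setT cons_measure.
Proof.
have /sigma_finiteP[F [TF ndF Foo]] := sigma_finiteT (@lebesgue_measure R).
have /sigma_finiteP[G [TG ndG Goo]] := sigma_finiteT mu.
exists (fun k => @tuncons n @^-1` (F k `*` G k)).
  rewrite -preimage_bigcup (_ : \bigcup_k _ = setT) ?preimage_setT//.
  rewrite -subTset -setXTT TF TG => -[x t] [/= [i _ Fix] [j _ Gjt]].
  exists (maxn i j) => //; split.
  - by move: x Fix; exact/subsetPset/ndF/leq_maxl.
  - by move: t Gjt; exact/subsetPset/ndG/leq_maxr.
move=> k; have [mF Fk] := Foo k; have [mG Gk] := Goo k; split.
  rewrite -[X in measurable X]setTI; apply: measurable_tuncons => //.
  exact: measurableX.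
rewrite /cons_measure /pushforward -comp_preimage.
rewrite (_ : _ \o _ = id); last by apply/funext => x; exact: tconsK.
by rewrite preimage_id product_measure1E// lte_mul_pinfty// ge0_fin_numE.
Qed.

HB.instance Definition _ := Measure_isSigmaFinite.Build _ _ _ cons_measure
  cons_measure_sigma_finite.

End cons_measure.

Fixpoint lebesgue_tuple n : {sigma_finite_measure set (n.-tuple T) -> \bar R} :=
  match n with
  | 0 => \d_([tuple] : 0.-tuple T)
  | n'.+1 => cons_measure (lebesgue_tuple n')
  end.

End lebesgue_tuple.

Section angles.
Variables (R : realType) (m n : nat).
Implicit Types (x y u p : 'rV[R]_m) (D A : set 'rV[R]_m) (U : 'I_n -> 'rV[R]_m).

Definition dot x y : R := \sum_i x 0 i * y 0 i.

Definition enorm x : R := Num.sqrt (dot x x).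

Definition aff U : set 'rV[R]_m :=
  [set x | exists2 a : 'I_n -> R, \sum_i a i = 1 & x = \sum_i a i *: U i].

Definition conv_hull U : set 'rV[R]_m :=
  [set x | exists a : 'I_n -> R,
     [/\ forall i, 0 <= a i, \sum_i a i = 1 & x = \sum_i a i *: U i]].

Definition orth_proj D u p :=
  D p /\ forall x, D x -> dot (u - p) (x - p) = 0.

Definition rel_interior D A : set 'rV[R]_m :=
  [set p | D p /\ within D (nbhs p) A].

Definition angle u U : set 'rV[R]_m :=
  [set x | exists2 a : 'I_n -> R,
     forall i, 0 <= a i & x = \sum_i a i *: (U i - u)].

(* Q is the matrix of a linear isometry t |-> t *m Q from R^n onto an
   n-dimensional linear subspace of R^m that contains A. *)
Definition isometric_chart A (Q : 'M[R]_(n, m)) :=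
  Q *m Q^T = 1%:M /\ forall x, A x -> (x <= Q)%MS.

(* n-dimensional volume of a subset A of R^m lying in some n-dimensional
   linear subspace: the Lebesgue measure of A read in an isometric chart. By
   orthogonal invariance, the value does not depend on the chart chosen by
   xget. Such a chart exists for every angle(u, U) as soon as n <= m; without
   one, volume n A is meaningless. *)
Definition volume A : \bar R :=
  let Q := xget 0 (isometric_chart A) in
  lebesgue_tuple R n [set t | A ((\row_i tnth t i) *m Q)].

Definition angle_norm u U : \bar R :=
  volume (angle u U `&` [set x | enorm x <= 1]).

End angles.

(* Main.v *)
Require Import Defs.
From HB Require Import structures.
From mathcomp Require Import all_boot all_order all_algebra.
From mathcomp Require Import all_classical all_reals all_analysis.
From mathcomp Require Import measurable_realfun ring lra.
Import Order.TTheory GRing.Theory Num.Theory.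
Local Open Scope ring_scope.
Set Implicit Arguments.
Unset Strict Implicit.
Unset Printing Implicit Defensive.
Import numFieldNormedType.Exports.
Local Open Scope classical_set_scope.

(* Write a_i = u_i - u, w = v - u and q = p - u. Since w is orthogonal to every
   a_i, the Gram matrix of the vectors u_i - v is that of the a_i with |w|^2 added
   to each entry. Measured from u and v, the simplex U thus sits at distances
   h = |q| and sqrt (h^2 + |w|^2) above the foot of the same perpendicular; after
   rescaling to a common height, the angle at v becomes, up to an isometry, the
   cone over the simplex U contracted towards p. As p is interior to the simplex,
   this cone lies inside the angle at u and avoids its boundary.

   Independence of the volume from the chart requires the invariance of the
   Lebesgue measure on R^n under orthogonal maps, which is deduced from its
   translation invariance by a Tonelli argument. *)

(** * Translation invariance of the Lebesgue measure on the line *)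

Section lebesgue_shift.
Context {R : realType}.
Local Notation T := (measurableTypeR R).
Local Notation mu := (@lebesgue_measure R).

Let shiftr (a : R) (x : T) : T := x + a.

Let measurable_shiftr (a : R) : measurable_fun [set: T] (shiftr a).
Proof. exact: measurable_funD. Qed.

HB.instance Definition _ (a : R) :=
  isMeasurableFun.Build _ _ _ _ (shiftr a) (measurable_shiftr a).

(** A measure is recognised as Lebesgue by its values on half-open intervals, and the preimage of
    one under the translation has the same length. *)
Lemma lebesgue_measure_shift (a : R) (A : set T) :
  measurable A -> mu [set x | A (x + a)] = mu A.
Proof.
move=> mA; apply/esym.
apply: (@lebesgue_measure_unique R (pushforward mu (shiftr a))) => //.
move=> X [[b c] /= bc <-].
rewrite /pushforward (_ : shiftr a @^-1` _ = `]b - a, c - a]%classic).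
  rewrite !lebesgue_measure_itv /= !lte_fin ltrD2r.
  by case: ifP => // _; rewrite -!EFinB opprB addrA subrK.
by apply/seteqP; split => x /=; rewrite !in_itv/= ltrBlDr lerBrDr.
Qed.

Lemma ge0_integral_shift (a : R) (f : T -> \bar R) :
  measurable_fun [set: T] f -> (forall x, 0 <= f x)%E ->
  (\int[mu]_x f (x + a)%R = \int[mu]_x f x)%E.
Proof.
move=> mf f0.
have := @ge0_integral_pushforward _ _ T T _ _ (measurable_shiftr a) mu setT f
  measurableT mf (fun y _ => f0 y).
rewrite preimage_setT => <-.
apply: (@eq_measure_integral _ T R _ mu (pushforward mu (shiftr a))) => A mA _.
exact: lebesgue_measure_shift.
Qed.
End lebesgue_shift.

(** * Volume of sets of row vectors and slicing along the first coordinate *)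

Section row_measure.
Context {R : realType}.
Local Notation T := (measurableTypeR R).

(** Tuples carry the product sigma-algebra and [lebesgue_tuple], while matrices act on rows; sets of
    rows are measured through this bijection. *)
Definition row_of_tuple n (t : n.-tuple T) : 'rV[R]_n := \row_i tnth t i.

Definition tuple_of_row n (x : 'rV[R]_n) : n.-tuple T := [tuple x 0 i | i < n].

Lemma tuple_of_rowK n : cancel (@tuple_of_row n) (@row_of_tuple n).
Proof. by move=> x; apply/rowP => i; rewrite mxE tnth_mktuple. Qed.

Definition rmeasurable n (A : set 'rV[R]_n) :=
  measurable [set t | A (row_of_tuple t)].

Definition rvol n (A : set 'rV[R]_n) : \bar R :=
  lebesgue_tuple R n [set t | A (row_of_tuple t)].

(** The sigma-algebra on tuples is generated by the coordinates, so measurability can be checked one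
    coordinate at a time. *)
Lemma measurable_preimage_row d (X : measurableType d) n (f : X -> 'rV[R]_n)
    (A : set 'rV[R]_n) :
  (forall i, measurable_fun [set: X] (fun x => f x 0 i : T)) ->
  rmeasurable A -> measurable [set x | A (f x)].
Proof.
move=> mf mA.
have mg : measurable_fun [set: X] (fun x => tuple_of_row (f x)).
  apply/measurable_fun_tnthP => i; rewrite (_ : _ \o _ = fun x => f x 0 i)//.
  by apply/funext => x; rewrite /= tnth_mktuple.
have := mg measurableT _ mA; rewrite setTI; congr measurable.
by apply/seteqP; split => x; rewrite /preimage /= tuple_of_rowK.
Qed.

Lemma measurable_coord_row n i : measurable_fun [set: n.-tuple T] (fun t => row_of_tuple t 0 i : T).
Proof.
rewrite (_ : (fun _ => _) = (fun t => tnth t i)); first exact: measurable_tnth.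
by apply/funext => t; rewrite mxE.
Qed.

Lemma measurable_coord_mulmx d (X : measurableType d) n p (f : X -> 'rV[R]_n) (A : 'M[R]_(n, p)) j :
  (forall i, measurable_fun [set: X] (fun x => f x 0 i : T)) ->
  measurable_fun [set: X] (fun x => (f x *m A) 0 j : T).
Proof.
move=> mf; rewrite (_ : (fun _ => _) = (fun x => \sum_i f x 0 i * A i j)).
  by apply: measurable_sum => i; apply: measurable_funM => //; exact: mf.
by apply/funext => x; rewrite mxE.
Qed.

Lemma measurable_coordD d (X : measurableType d) n (f g : X -> 'rV[R]_n) j :
  (forall i, measurable_fun [set: X] (fun x => f x 0 i : T)) ->
  (forall i, measurable_fun [set: X] (fun x => g x 0 i : T)) ->
  measurable_fun [set: X] (fun x => (f x + g x) 0 j : T).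
Proof.
move=> mf mg; rewrite (_ : (fun _ => _) = (fun x => f x 0 j + g x 0 j)).
  by apply: measurable_funD; [exact: mf|exact: mg].
by apply/funext => x; rewrite mxE.
Qed.

Definition row_cons n (x : R) (y : 'rV[R]_n) : 'rV[R]_n.+1 :=
  \row_i if unlift ord0 i is Some j then y 0 j else x.

Lemma row_cons0 n x (y : 'rV[R]_n) : row_cons x y 0 0 = x.
Proof. by rewrite mxE unlift_none. Qed.

Lemma row_consS n x (y : 'rV[R]_n) i : row_cons x y 0 (lift ord0 i) = y 0 i.
Proof. by rewrite mxE liftK. Qed.

Lemma row_of_tcons n (x : T) (t : n.-tuple T) :
  row_of_tuple (tcons (x, t)) = row_cons x (row_of_tuple t).
Proof.
apply/rowP => i; rewrite mxE; case: (unliftP ord0 i) => [j|] ->.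
  by rewrite row_consS tnthS mxE.
by rewrite row_cons0 tnth0.
Qed.

Lemma rmeasurable_cons n (A : set 'rV[R]_n.+1) :
  rmeasurable A -> measurable [set p : T * n.-tuple T | A (row_cons p.1 (row_of_tuple p.2))].
Proof.
move=> mA; have := @measurable_tcons R n measurableT _ mA; rewrite setTI; congr measurable.
by apply/seteqP; split => -[x t] /=; rewrite /preimage /= row_of_tcons.
Qed.

(** The basis of the inductions on the dimension: the measure is the image of a product measure,
    which integrates the measures of sections. *)
Lemma rvolS n (A : set 'rV[R]_n.+1) :
  rvol A = (\int[lebesgue_measure]_(x in [set: T]) rvol [set y | A (row_cons x y)])%E.
Proof.
rewrite /rvol [LHS]/= /cons_measure /pushforward /product_measure1.
apply: eq_integral => x _ /=; congr (lebesgue_tuple R n _).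
by apply/seteqP; split => t /=; rewrite -row_of_tcons /xsection/= inE.
Qed.

Lemma measurable_rvol_cons n (A : set 'rV[R]_n.+1) : rmeasurable A ->
  measurable_fun [set: T] (fun x : T => rvol [set y | A (row_cons x y)]).
Proof.
move=> /rmeasurable_cons mA.
have := measurable_fun_xsection (lebesgue_tuple R n) mA.
congr measurable_fun; apply/funext => x; rewrite /= /rvol; congr (lebesgue_tuple R n _).
by apply/seteqP; split => t /=; rewrite /xsection/= inE.
Qed.

End row_measure.

(** * Translations, Tonelli, cubes and hyperplanes in R^n *)

Section rvol_theory.
Context {R : realType}.
Local Notation T := (measurableTypeR R).

Lemma row_consD n (x x' : R) (y y' : 'rV[R]_n) :
  row_cons x y + row_cons x' y' = row_cons (x + x') (y + y').
Proof.
apply/rowP => i; rewrite mxE; case: (unliftP ord0 i) => [j|] ->.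
  by rewrite !row_consS mxE.
by rewrite !row_cons0.
Qed.

Lemma row_consE n (a : 'rV[R]_n.+1) :
  a = row_cons (a 0 0) (\row_i a 0 (lift ord0 i)).
Proof.
apply/rowP => i; case: (unliftP ord0 i) => [j|] ->.
  by rewrite row_consS mxE.
by rewrite row_cons0.
Qed.

Lemma rmeasurable_consr n (A : set 'rV[R]_n.+1) x :
  rmeasurable A -> rmeasurable [set y | A (row_cons x y)].
Proof.
move=> mA; apply: (measurable_preimage_row _ mA) => i.
case: (unliftP ord0 i) => [j|] ->.
  under eq_fun do rewrite row_consS; exact: measurable_coord_row.
by under eq_fun do rewrite row_cons0; exact: measurable_cst.
Qed.

Lemma rmeasurable_mulmxD n p (A : 'M[R]_(n, p)) (b : 'rV[R]_p) (F : set 'rV[R]_p) :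
  rmeasurable F -> rmeasurable [set x | F (x *m A + b)].
Proof.
move=> mF; apply: (measurable_preimage_row _ mF) => i.
apply: (@measurable_coordD _ _ _ _ (fun t => row_of_tuple t *m A) (cst b)) => j //.
by apply: measurable_coord_mulmx => k; exact: measurable_coord_row.
Qed.

Lemma rvol_ge0 n (A : set 'rV[R]_n) : (0 <= rvol A)%E.
Proof. exact: measure_ge0. Qed.

Lemma rvol0 n : rvol (@set0 'rV[R]_n) = 0%E.
Proof. exact: measure0. Qed.

Lemma le_rvol n (A B : set 'rV[R]_n) : rmeasurable A -> rmeasurable B ->
  A `<=` B -> (rvol A <= rvol B)%E.
Proof.
by move=> mA mB AB; apply: le_measure; rewrite ?inE// => t /=; exact: AB.
Qed.

(** By induction on n: invariance on the line absorbs the first coordinate of a, the induction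
    hypothesis absorbs the others in each slice. *)
Lemma rvol_shift n (a : 'rV[R]_n) (A : set 'rV[R]_n) :
  rmeasurable A -> rvol [set x | A (x + a)] = rvol A.
Proof.
elim: n a A => [|n IH] a A mA.
  by congr rvol; apply/funext => x /=; congr A; apply/rowP => -[].
rewrite !rvolS -[RHS](@ge0_integral_shift _ (a 0 0)); last 2 first.
- exact: measurable_rvol_cons.
- by move=> x; exact: rvol_ge0.
apply: eq_integral => x _.
rewrite -[RHS](IH (\row_i a 0 (lift ord0 i))); last exact: rmeasurable_consr.
by congr rvol; apply/funext => y /=; rewrite [in LHS](row_consE a) row_consD.
Qed.

(** Both sides are the product measure of [W], with its sections integrated in either order. *)
Lemma rvol_tonelli n p (W : 'rV[R]_n -> 'rV[R]_p -> Prop) :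
  measurable [set z : n.-tuple T * p.-tuple T |
    W (row_of_tuple z.1) (row_of_tuple z.2)] ->
  (\int[lebesgue_tuple R n]_t rvol [set y | W (row_of_tuple t) y] =
   \int[lebesgue_tuple R p]_t rvol [set x | W x (row_of_tuple t)])%E.
Proof.
move=> mW.
have := indic_fubini_tonelli (lebesgue_tuple R n) (lebesgue_tuple R p) mW.
rewrite indic_fubini_tonelli_FE // indic_fubini_tonelli_GE //.
have -> : (lebesgue_tuple R p \o xsection [set z | W (row_of_tuple z.1) (row_of_tuple z.2)]) =
  (fun t => rvol [set y | W (row_of_tuple t) y]).
  apply/funext => t /=; rewrite /rvol; congr (lebesgue_tuple R p _).
  by apply/seteqP; split => s /=; rewrite /xsection/= inE.
move=> ->; apply: eq_integral => t _; rewrite /rvol /=; congr (lebesgue_tuple R n _).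
by apply/seteqP; split => s /=; rewrite /ysection/= inE.
Qed.

Definition cube n (s : 'rV[R]_n) (e : R) : set 'rV[R]_n :=
  [set x | forall i, `|s 0 i - x 0 i| < e].

Lemma rmeasurable_cube n (s : 'rV[R]_n) e : rmeasurable (cube s e).
Proof.
rewrite /rmeasurable (_ : [set _ | _] =
    \bigcap_(i in [set: 'I_n]) [set t | `|s 0 i - row_of_tuple t 0 i| < e]).
  apply: fin_bigcap_measurable => [|i _]; first exact: finite_finset.
  have mf : measurable_fun [set: n.-tuple T] (fun t => `|s 0 i - row_of_tuple t 0 i|).
    apply: measurableT_comp => //; apply: measurable_funB => //.
    exact: measurable_coord_row.
  have := mf measurableT `]-oo, e[%classic (measurable_itv _).
  by rewrite setTI; congr measurable; apply/seteqP; split => t /=; rewrite in_itv/=.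
apply/seteqP; split => t /=; first by move=> h i _; exact: h.
by move=> h i; exact: h.
Qed.

Lemma rvol_cube n (s : 'rV[R]_n) e : 0 < e -> rvol (cube s e) = ((e *+ 2) ^+ n)%:E.
Proof.
move=> e0; elim: n s => [|n IH] s.
  rewrite /rvol /= diracE mem_set//=; last by case.
(* The slice at x is a cube of dimension n when x is within e of the first coordinate of s, and is
   empty otherwise. *)
rewrite rvolS (eq_integral (fun x : T => ((e *+ 2) ^+ n * \1_(ball (s 0 0) e) x)%:E)); last first.
  move=> x _; rewrite indicE.
  have [xs|xs] := boolP (x \in _).
    rewrite mulr1 -(IH (\row_i s 0 (lift ord0 i))); congr rvol.
    move: xs; rewrite inE /= /ball /= => xs.
    apply/seteqP; split => y /= h i.
      by have := h (lift ord0 i); rewrite row_consS mxE.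
    case: (unliftP ord0 i) => [j|] ->; last by rewrite row_cons0.
    by have := h j; rewrite row_consS mxE.
  rewrite mulr0 (_ : [set y | _] = set0) ?rvol0//.
  apply/seteqP; split => y //= /(_ 0); rewrite row_cons0 => h.
  by move: xs; rewrite notin_setE; apply.
under eq_integral do rewrite EFinM.
rewrite ge0_integralZl//; last 2 first.
- apply/measurable_EFinP; apply: measurable_indic; exact: measurable_ball.
- by rewrite lee_fin exprn_ge0// mulrn_wge0// ltW.
rewrite integral_indic//; last exact: measurable_ball.
rewrite setIT [X in (_ * X)%E](_ : _ = (e *+ 2)%:E).
  by rewrite -EFinM exprSr.
exact: lebesgue_measure_ball (ltW e0).
Qed.

(* S is not assumed measurable, so this also applies to degenerate cones. *)
Lemma rvol_sub_hyperplane n (b : 'cV[R]_n) (c : R) (S : set 'rV[R]_n) : b != 0 ->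
  S `<=` [set x | (x *m b) 0 0 = c] -> rvol S = 0%E.
Proof.
elim: n b c S => [|n IH] b c S b0 Sbc.
  by case/eqP: b0; apply/matrixP => -[].
pose b' : 'cV[R]_n := \col_i b (lift ord0 i) 0.
have bE x y : (row_cons x y *m b) 0 0 = x * b 0 0 + (y *m b') 0 0.
  rewrite !mxE big_ord_recl row_cons0; congr (_ + _).
  by apply: eq_bigr => i _; rewrite row_consS mxE.
rewrite rvolS.
(* If [b'] is nonzero, every slice lies in a hyperplane of R^n. Otherwise only the slice at [x0] can
   be nonempty; its volume may be infinite, but it is weighted by the null measure of a point. *)
have [b'0|b'0] := eqVneq b' 0; last first.
  rewrite integral0_eq// => x _; apply: (IH _ (c - x * b 0 0) _ b'0) => y /= /Sbc/=.
  by rewrite bE => <-; rewrite addrC addKr.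
have b00 : b 0 0 != 0.
  apply: contraNneq b0 => b00; apply/eqP/colP => i.
  rewrite mxE; case: (unliftP ord0 i) => [j|] ->//.
  by move/colP/(_ j): b'0; rewrite !mxE.
pose x0 : T := c / b 0 0.
rewrite (eq_integral (fun x : T =>
    rvol [set y | S (row_cons x0 y)] * (\1_[set x0] x)%:E)%E); last first.
  move=> x _; rewrite indicE in_set1; have [->|xx0] := eqVneq x x0.
    by rewrite mule1.
  rewrite mule0 (_ : [set y | _] = set0) ?rvol0//.
  apply/seteqP; split => y //= /Sbc/=; rewrite bE b'0 mulmx0 mxE addr0 => xb.
  by move/eqP: xx0; apply; rewrite /x0 -xb mulfK.
rewrite ge0_integralZl//; last exact/measurable_EFinP/measurable_indic.
rewrite integral_indic// setIT [X in (_ * X)%E](_ : _ = 0%E) ?mule0//.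
exact: lebesgue_measure_set1.
Qed.

End rvol_theory.

(** * The unit ball and invariance of volume under orthogonal maps *)

Section rvol_orthogonal.
Context {R : realType}.
Local Notation T := (measurableTypeR R).

Lemma dotE n (x y : 'rV[R]_n) : dot x y = (x *m y^T) 0 0.
Proof. by rewrite mxE; apply: eq_bigr => i _; rewrite mxE. Qed.

Lemma dot_ge0 n (x : 'rV[R]_n) : 0 <= dot x x.
Proof. by apply: sumr_ge0 => i _; rewrite -expr2 sqr_ge0. Qed.

Lemma sqr_coord_le_dot n (x : 'rV[R]_n) i : x 0 i ^+ 2 <= dot x x.
Proof.
by rewrite /dot (bigD1 i)//= -expr2 lerDl sumr_ge0// => j _; rewrite -expr2 sqr_ge0.
Qed.

Lemma dot_mul_orthogonal m n (x : 'rV[R]_n) (O : 'M[R]_(n, m)) :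
  O *m O^T = 1%:M -> dot (x *m O) (x *m O) = dot x x.
Proof. by move=> OO; rewrite !dotE trmx_mul mulmxA -(mulmxA x) OO mulmx1. Qed.

Definition unit_ball n : set 'rV[R]_n := [set x | dot x x <= 1].

Lemma rmeasurable_unit_ball n : rmeasurable (@unit_ball n).
Proof.
have mf : measurable_fun [set: n.-tuple T]
    (fun t => dot (row_of_tuple t) (row_of_tuple t) : T).
  by apply: measurable_sum => i; apply: measurable_funM; exact: measurable_coord_row.
have := mf measurableT `]-oo, 1]%classic (measurable_itv _).
by rewrite setTI; congr measurable; apply/seteqP; split => t /=; rewrite in_itv/=.
Qed.

Lemma unit_ball_sub_cube n : @unit_ball n `<=` cube 0 2.
Proof.
move=> x /= x1 i; rewrite mxE sub0r normrN.
apply: (@le_lt_trans _ _ 1); last by rewrite ltr1n.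
rewrite -(@ler_pXn2r _ 2)// ?nnegrE// expr1n real_normK ?num_real//.
exact: le_trans (sqr_coord_le_dot _ _) x1.
Qed.

Lemma rvol_unit_ball_lty n : (rvol (@unit_ball n) < +oo)%E.
Proof.
apply: le_lt_trans (le_rvol (@rmeasurable_unit_ball n) (rmeasurable_cube 0 2)
  (@unit_ball_sub_cube n)) _.
by rewrite rvol_cube// ltry.
Qed.

Lemma rvol_unit_ball_gt0 n : (0 < rvol (@unit_ball n))%E.
Proof.
(* In the cube of half-side 1/(n+1) each squared coordinate is at most 1/(n+1), so the n of them sum
   to at most 1. Using n+1 covers n = 0. *)
have e0 : 0 < n.+1%:R^-1 :> R by rewrite invr_gt0.
apply: (@lt_le_trans _ _ (rvol (cube (0 : 'rV[R]_n) n.+1%:R^-1))).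
  by rewrite rvol_cube// lte_fin exprn_gt0// mulrn_wgt0.
apply: le_rvol; [exact: rmeasurable_cube|exact: rmeasurable_unit_ball|] => x /= xe.
apply: (@le_trans _ _ (\sum_(i < n) n.+1%:R^-1)).
  apply: ler_sum => i _; have := xe i; rewrite mxE sub0r normrN => xi.
  rewrite -expr2 -real_normK ?num_real// expr2.
  apply: (@le_trans _ _ (n.+1%:R^-1 * 1)); last by rewrite mulr1.
  apply: ler_pM => //; first exact: ltW.
  by apply: le_trans (ltW xi) _; rewrite invf_le1// ler1n.
by rewrite sumr_const card_ord -[_ *+ n]mulr_natl ler_pdivrMr// mul1r ler_nat.
Qed.

Lemma measurable_row_prod (n p q : nat) (A : 'M[R]_(n, q)) (B : 'M[R]_(p, q))
    (F : set 'rV[R]_q) : rmeasurable F ->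
  measurable [set z : n.-tuple T * p.-tuple T |
    F (row_of_tuple z.1 *m A + row_of_tuple z.2 *m B)].
Proof.
move=> mF; apply: (measurable_preimage_row _ mF) => i.
apply: (@measurable_coordD _ _ _ _ (fun z => row_of_tuple z.1 *m A)
  (fun z => row_of_tuple z.2 *m B)) => j; apply: measurable_coord_mulmx => k.
- by apply: (measurableT_comp (measurable_coord_row k)).
- by apply: (measurableT_comp (measurable_coord_row k)).
Qed.

(* The measure of {(x, y) | x \in B, x + y O \in F}, B the unit ball, is
   |B| |O^-1 F| when y is integrated first; shifting x by - y O and integrating
   y first again gives |F| |B|, since O preserves B. *)
Lemma rvol_orthogonal n (O : 'M[R]_n) (F : set 'rV[R]_n) :
  O *m O^T = 1%:M -> rmeasurable F -> rvol [set x | F (x *m O)] = rvol F.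
Proof.
move=> OO mF; have OO' : O^T *m O = 1%:M by apply: mulmx1C.
set B := @unit_ball n; have mB : rmeasurable B := @rmeasurable_unit_ball n.
have BE x y : B (y - x *m O^T) = B (x - y *m O).
  rewrite /B /unit_ball/=; congr (_ <= 1 : Prop).
  rewrite -(dot_mul_orthogonal (y - _) OO) mulmxBl -mulmxA OO' mulmx1.
  by rewrite -opprB !dotE linearN/= mulmxN mulNmx opprK.
have B0 : (0 < rvol B)%E := @rvol_unit_ball_gt0 n.
have Boo : (rvol B < +oo)%E := @rvol_unit_ball_lty n.
(* From here on B enters only through its measurability, the invariance [BE], and its positive
   finite volume, which is cancelled at the end. *)
clearbody B.
have mFO : rmeasurable [set x | F (x *m O)].
  by under eq_set do rewrite -[_ *m O]addr0; exact: rmeasurable_mulmxD.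
have indic_int (D : set 'rV[R]_n) (c : \bar R) : rmeasurable D -> (0 <= c)%E ->
    (\int[lebesgue_tuple R n]_t (c * (\1_D (row_of_tuple t))%:E) = c * rvol D)%E.
  move=> mD c0.
  rewrite (eq_integral (fun t => c * (\1_[set s | D (row_of_tuple s)] t)%:E)%E)//.
  rewrite ge0_integralZl//; last exact/measurable_EFinP/measurable_indic.
  by rewrite integral_indic// setIT.
have m1 (D : set 'rV[R]_n) : rmeasurable D ->
    measurable [set z : n.-tuple T * n.-tuple T | D (row_of_tuple z.1)].
  move=> mD; have := measurable_row_prod 1%:M (0 : 'M[R]_n) mD.
  by under eq_set do rewrite mulmx1 mulmx0 addr0.
have : (rvol [set x | F (x *m O)] * rvol B = rvol B * rvol F)%E.
  rewrite -!indic_int//; [|exact: rvol_ge0..].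
  rewrite [LHS](eq_integral (fun t =>
      rvol [set y | B (row_of_tuple t) /\ F (row_of_tuple t + y *m O)])); last first.
    move=> t _; apply/esym; rewrite indicE; have [tB|tB] := boolP (_ \in _).
      rewrite mule1 -[RHS](rvol_shift (row_of_tuple t *m O^T))//; congr rvol.
      apply/seteqP; split => y /=; rewrite mulmxDl -mulmxA OO' mulmx1 addrC.
        by case.
      by split => //; exact: set_mem tB.
    rewrite mule0 (_ : [set y | _] = set0) ?rvol0//.
    by apply/seteqP; split => y //= -[/mem_set]; rewrite (negbTE tB).
  rewrite (rvol_tonelli (W := fun x y => B x /\ F (x + y *m O))); last first.
    apply: measurableI; first exact: m1.
    by have := measurable_row_prod 1%:M O mF; under eq_set do rewrite mulmx1.
  rewrite [RHS](eq_integral (fun t =>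
      rvol [set y | F (row_of_tuple t) /\ B (row_of_tuple t - y *m O)])); last first.
    move=> t _; apply/esym; rewrite indicE; have [tB|tB] := boolP (_ \in _).
      rewrite mule1 -[RHS](rvol_shift (- (row_of_tuple t *m O^T)))//; congr rvol.
      apply/seteqP; split => y /=; rewrite BE; first by case.
      by split => //; exact: set_mem tB.
    rewrite mule0 (_ : [set y | _] = set0) ?rvol0//.
    by apply/seteqP; split => y //= -[/mem_set]; rewrite (negbTE tB).
  rewrite [RHS](rvol_tonelli (W := fun x y => F x /\ B (x - y *m O))); last first.
    apply: measurableI; first exact: m1.
    have := measurable_row_prod 1%:M (- O) mB.
    by under eq_set do rewrite mulmx1 mulmxN.
  apply: eq_integral => t _.
  rewrite -[RHS](rvol_shift (row_of_tuple t *m O)); last first.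
    apply: measurableI => //.
    have := rmeasurable_mulmxD 1%:M (- (row_of_tuple t *m O)) mB.
    by under eq_set do rewrite mulmx1.
  by congr rvol; apply/seteqP; split => x /=; rewrite addrK => -[].
have Bfin : rvol B \is a fin_num by rewrite ge0_fin_numE// rvol_ge0.
rewrite muleC => BF.
by apply/le_anti/andP; split; rewrite -(lee_pmul2l Bfin B0) BF.
Qed.

End rvol_orthogonal.

(** * Orthonormal frames *)

Section orthonormal_frame.
Context {R : realType}.

Lemma dot_eq0 n (x : 'rV[R]_n) : (dot x x == 0) = (x == 0).
Proof.
apply/idP/eqP => [|->]; last by rewrite dotE mul0mx mxE.
rewrite /dot psumr_eq0 => [|i _]; last by rewrite -expr2 sqr_ge0.
move/allP => h; apply/rowP => i; rewrite mxE.
by have := h i (mem_index_enum i); rewrite mulf_eq0 orbb => /eqP.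
Qed.

Lemma dotZZ n (k : R) (x : 'rV[R]_n) :
  dot (k *: x) (k *: x) = k ^+ 2 * dot x x.
Proof.
by rewrite /dot mulr_sumr; apply: eq_bigr => i _; rewrite !mxE; ring.
Qed.

Lemma dot_gt0 n (x : 'rV[R]_n) : (0 < dot x x) = (x != 0).
Proof. by rewrite lt_def dot_ge0 andbT dot_eq0. Qed.

(* Gram-Schmidt, completed by arbitrary orthonormal vectors if a is not free. *)
Lemma orthonormal_frame m n (a : 'M[R]_(n, m)) : (n <= m)%N ->
  exists Q : 'M[R]_(n, m), Q *m Q^T = 1%:M /\ (a <= Q)%MS.
Proof.
elim: n a => [|n IH] a nm.
  by exists 0; split; [apply/matrixP => -[]|apply/row_subP => -[]].
have [Q [QQ aQ]] := IH (dsubmx (a : 'M[R]_(1 + n, m))) (ltnW nm).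
pose a0 : 'rV[R]_m := usubmx (a : 'M[R]_(1 + n, m)).
have [r [r0 rQ ar]] : exists r : 'rV[R]_m,
    [/\ r != 0, r *m Q^T = 0 & (a0 <= col_mx r Q)%MS].
  pose r := a0 - a0 *m Q^T *m Q.
  have rQ : r *m Q^T = 0 by rewrite mulmxBl -!mulmxA QQ mulmx1 subrr.
  have [r0|r0] := eqVneq r 0; last first.
    exists r; split => //; have aE : r + a0 *m Q^T *m Q = a0 by rewrite subrK.
    by rewrite -[X in (X <= _)%MS]aE -addsmxE addmx_sub_adds// submxMl.
  (* Here [a0] already lies in the span of Q. As Q has n < m rows, some nonzero vector is orthogonal
     to all of them. *)
  have [i ri] : exists i, row i (kermx Q^T) != 0.
    apply/existsP; apply: contraT => /existsPn h.
    have k0 : kermx Q^T = 0.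
      by apply/row_matrixP => i; rewrite row0; apply/eqP; have := h i; rewrite negbK.
    have := mxrank_ker Q^T; rewrite k0 mxrank0 => /esym/eqP; rewrite subn_eq0.
    by move=> /leq_trans/(_ (rank_leq_col _)); rewrite leqNgt nm.
  exists (row i (kermx Q^T)); split => //.
    by rewrite -row_mul mulmx_ker row0.
  rewrite -(addsmxE _ Q) (submx_trans _ (addsmxSr _ _))//.
  by move/eqP: r0; rewrite subr_eq0 => /eqP ->; exact: submxMl.
pose k := (Num.sqrt (dot r r))^-1; pose q := k *: r.
have rr0 : 0 < dot r r by rewrite dot_gt0.
have k0 : k != 0 by rewrite invr_eq0 gt_eqF// sqrtr_gt0.
have qq : q *m q^T = 1%:M.
  rewrite /q linearZ/= -scalemxAl -scalemxAr scalerA [r *m r^T]mx11_scalar -dotE.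
  rewrite scale_scalar_mx; congr (_%:M).
  by rewrite /k -invfM -expr2 sqr_sqrtr ?ltW// mulVf// gt_eqF.
have qQ : q *m Q^T = 0 by rewrite -scalemxAl rQ scaler0.
have qQqQ : col_mx q Q *m (col_mx q Q)^T = 1%:M.
  rewrite tr_col_mx mul_col_row qq qQ QQ.
  rewrite (_ : Q *m q^T = 0); last by rewrite -[LHS]trmxK trmx_mul trmxK qQ trmx0.
  exact/esym/scalar_mx_block.
exists (col_mx q Q); split; first exact: qQqQ.
have : (col_mx (usubmx (a : 'M[R]_(1 + n, m))) (dsubmx (a : 'M[R]_(1 + n, m)))
          <= col_mx q Q)%MS; last by rewrite vsubmxK.
rewrite col_mx_sub; apply/andP; split.
  apply: submx_trans ar _; rewrite -!addsmxE addsmxS//.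
  have qr : k^-1 *: q = r by rewrite /q scalerA mulVf// scale1r.
  by rewrite -[X in (X <= _)%MS]qr scalemx_sub.
by apply: submx_trans aQ _; rewrite -addsmxE addsmxSr.
Qed.

End orthonormal_frame.

(** * Angles read in a chart, as cones in R^n *)

Section angle_volume.
Context {R : realType}.

Definition conic n p (A : 'M[R]_(n, p)) : set 'rV[R]_p :=
  [set x | exists2 c : 'rV[R]_n, forall i, 0 <= c 0 i & x = c *m A].

Lemma angleE m n (u : 'rV[R]_m) (U : 'I_n -> 'rV[R]_m) :
  angle u U = conic (\matrix_i (U i - u)).
Proof.
apply/seteqP; split => x /= [c c0 ->].
  exists (\row_i c i); first by move=> i; rewrite mxE.
  by rewrite mulmx_sum_row; apply: eq_bigr => i _; rewrite mxE rowK.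
exists (c 0) => //.
by rewrite mulmx_sum_row; apply: eq_bigr => i _; rewrite rowK.
Qed.

Lemma enorm_le1 m (x : 'rV[R]_m) : (enorm x <= 1) = (dot x x <= 1).
Proof. by rewrite /enorm -[X in _ <= X]sqrtr1 ler_sqrt. Qed.

(** In the chart Q picked by [xget] the generators become the rows of [a *m Q^T]. They depend on the
    choice, but their Gram matrix does not. *)
Lemma angle_normE m n (u : 'rV[R]_m) (U : 'I_n -> 'rV[R]_m) : (n <= m)%N ->
  let a := \matrix_i (U i - u) in
  exists2 A : 'M[R]_n, A *m A^T = a *m a^T &
    angle_norm u U = rvol (conic A `&` @unit_ball R n).
Proof.
move=> nm a; rewrite /angle_norm /volume.
set S := angle u U `&` _.
have [Q0 [QQ0 aQ0]] := orthonormal_frame a nm.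
(* A chart exists, so [xget] does not return its default 0. *)
have exQ : exists Q : 'M[R]_(n, m), isometric_chart S Q.
  exists Q0; split=> // x [+ _]; rewrite angleE => -[c _ ->].
  exact: mulmx_sub.
set Q := xget _ _; have [QQ SQ] : isometric_chart S Q := xgetPex 0 exQ.
have aQ : (a <= Q)%MS.
  apply/row_subP => i; rewrite rowK.
  (* The chart is only known to contain the truncated cone, so the generator is first scaled into
     the unit ball; this k works because s <= (1 + s)^2 for s >= 0. *)
  pose k := (1 + dot (U i - u) (U i - u))^-1.
  have d0 := dot_ge0 (U i - u).
  have k0 : 0 < k by rewrite invr_gt0 ltr_pwDl.
  have /SQ : S (k *: (U i - u)).
    split.
      exists (fun j => if j == i then k else 0).
        by move=> j; case: ifP => // _; exact: ltW.
      rewrite (bigD1 i)//= eqxx big1 ?addr0// => j ji.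
      by rewrite (negbTE ji) scale0r.
    rewrite /= enorm_le1 dotZZ exprVn ler_pdivrMl ?exprn_gt0 ?ltr_pwDl// mulr1.
    by rewrite sqrrD; nra.
  by rewrite (eqmx_scale _ (lt0r_neq0 k0)).
have aE : a *m Q^T *m Q = a.
  by case/submxP: aQ => D ->; rewrite -(mulmxA D) QQ mulmx1.
exists (a *m Q^T); first by rewrite trmx_mul trmxK mulmxA aE.
rewrite -[LHS]/(rvol [set x | S (x *m Q)]); congr rvol.
apply/seteqP; split => x /= [].
  rewrite angleE => -[c c0 xc]; rewrite /= enorm_le1 (dot_mul_orthogonal x QQ).
  move=> x1; split=> //; exists c => //.
  by rewrite -[LHS]mulmx1 -QQ mulmxA xc mulmxA.
move=> [c c0 xc] x1; split; last by rewrite /= enorm_le1 (dot_mul_orthogonal x QQ).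
by rewrite angleE; exists c => //; rewrite xc -mulmxA aE.
Qed.

End angle_volume.

(** * Simplicial cones: measurability, degeneracy, strict comparison *)

Section conic_volume.
Context {R : realType}.
Local Notation T := (measurableTypeR R).

Lemma conicE n (A : 'M[R]_n) : A \in unitmx ->
  conic A = [set x | forall i, 0 <= (x *m invmx A) 0 i].
Proof.
move=> uA; apply/seteqP; split => x /=; first by move=> [c c0 ->]; rewrite mulmxK.
by move=> h; exists (x *m invmx A); rewrite ?mulmxKV.
Qed.

Lemma rmeasurable_conic n (A : 'M[R]_n) : A \in unitmx -> rmeasurable (conic A).
Proof.
move=> uA; rewrite conicE// /rmeasurable (_ : [set _ | _] =
    \bigcap_(i in [set: 'I_n]) [set t | 0 <= (row_of_tuple t *m invmx A) 0 i]).
  apply: fin_bigcap_measurable => [|i _]; first exact: finite_finset.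
  have mf : measurable_fun [set: n.-tuple T]
      (fun t => (row_of_tuple t *m invmx A) 0 i : T).
    by apply: measurable_coord_mulmx => k; exact: measurable_coord_row.
  have := mf measurableT `[0, +oo[%classic (measurable_itv _).
  by rewrite setTI; congr measurable; apply/seteqP; split => t /=; rewrite in_itv/= andbT.
apply/seteqP; split => t /=; first by move=> h i _; exact: h.
by move=> h i; exact: h.
Qed.

(** The rows of a singular A all lie in a hyperplane through the origin, hence so does their
    cone. *)
Lemma rvol_conic_singular n (A : 'M[R]_n) (S : set 'rV[R]_n) :
  A \notin unitmx -> rvol (conic A `&` S) = 0%E.
Proof.
rewrite -unitmx_tr -row_free_unit -kermx_eq0 => kA.
have [i ki] : exists i, row i (kermx A^T) != 0.
  apply/existsP; apply: contraNT kA => /existsPn h.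
  by apply/eqP/row_matrixP => i; rewrite row0; apply/eqP; have := h i; rewrite negbK.
apply: (@rvol_sub_hyperplane _ _ (row i (kermx A^T))^T 0).
  by rewrite -(inj_eq trmx_inj) trmxK trmx0.
move=> x [[c _ ->] _] /=; rewrite -mulmxA.
rewrite (_ : A *m _ = 0) ?mulmx0 ?mxE//.
by rewrite -[LHS]trmxK trmx_mul trmxK -row_mul mulmx_ker row0 trmx0.
Qed.

Lemma continuous_mulmx_coord n p (A : 'M[R]_(n, p)) j :
  continuous (fun x : 'rV[R]_n => (x *m A) 0 j).
Proof.
rewrite (_ : (fun _ => _) = fun x : 'rV[R]_n => \sum_i x 0 i * A i j); last first.
  by apply/funext => x; rewrite mxE.
apply: continuous_big => [|i _]; first exact: add_continuous.
by move=> x; apply: continuousM; [exact: coord_continuous|exact: cst_continuous].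
Qed.

Lemma continuous_dot n : continuous (fun x : 'rV[R]_n => dot x x).
Proof.
rewrite /dot; apply: continuous_big => [|i _]; first exact: add_continuous.
by move=> x; apply: continuousM; exact: coord_continuous.
Qed.

Lemma nbhs_cube n (s : 'rV[R]_n) (P : set 'rV[R]_n) :
  nbhs s P -> exists2 e, 0 < e & cube s e `<=` P.
Proof.
move=> /nbhs_ballP[e /= e0 sP]; exists e => // x xs; apply: sP; split => // i j.
by rewrite (ord1 i); exact: xs.
Qed.

(* E misses a neighbourhood of the relative interior of the facet of the cone
   opposite to the i0-th generator, where the i0-th coordinate vanishes. *)
Lemma rvol_conic_lt n (A : 'M[R]_n) (E : set 'rV[R]_n) (i0 i1 : 'I_n) (d : R) :
  A \in unitmx -> i0 != i1 -> 0 < d -> rmeasurable E ->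
  E `<=` conic A `&` @unit_ball R n ->
  (forall x, E x -> d * \sum_i (x *m invmx A) 0 i <= (x *m invmx A) 0 i0) ->
  (rvol E < rvol (conic A `&` @unit_ball R n))%E.
Proof.
move=> uA i01 d0 mE EA Ed.
have mAB : rmeasurable (conic A `&` @unit_ball R n).
  by apply: measurableI; [exact: rmeasurable_conic|exact: rmeasurable_unit_ball].
(* Coefficients of a point interior to the cone that violates the inequality satisfied on E: the
   entry 1 at [i1] makes the sum exceed 1, while the entry at [i0] is only d/2. *)
pose b : 'rV[R]_n := \row_i if i == i0 then d / 2 else 1.
have b0 i : 0 < b 0 i by rewrite mxE; case: ifP => // _; rewrite divr_gt0.
have bsum : b 0 i0 < d * \sum_i b 0 i.
  apply: (@lt_le_trans _ _ d).
    by rewrite mxE eqxx ltr_pdivrMr// ltr_pMr// ltr1n.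
  rewrite ler_pMr// (bigD1 i1)//= [b 0 i1]mxE eq_sym (negbTE i01) lerDl.
  by apply: sumr_ge0 => i _; exact: ltW.
pose k := (1 + dot (b *m A) (b *m A))^-1.
have dd0 := dot_ge0 (b *m A).
have k0 : 0 < k by rewrite invr_gt0 ltr_pwDl.
pose s := k *: (b *m A).
have sA : s *m invmx A = k *: b by rewrite -scalemxAl mulmxK.
have s1 : dot s s < 1.
  rewrite dotZZ exprVn ltr_pdivrMl ?exprn_gt0 ?ltr_pwDl// mulr1.
  by rewrite sqrrD; nra.
have c0 i : 0 < (s *m invmx A) 0 i by rewrite sA mxE mulr_gt0.
have csum : (s *m invmx A) 0 i0 < d * \sum_i (s *m invmx A) 0 i.
  rewrite sA mxE (eq_bigr (fun i => k * b 0 i)); last by move=> i _; rewrite mxE.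
  by rewrite -mulr_sumr mulrCA ltr_pM2l.
(* All the inequalities at s are strict and continuous, so they persist on a cube around s, which E
   therefore misses. *)
have [e e0 sub] : exists2 e, 0 < e & cube s e `<=` (conic A `&` @unit_ball R n) `\` E.
  apply: nbhs_cube; rewrite conicE//.
  have nc : \forall x \near s, forall i, 0 < (x *m invmx A) 0 i.
    apply: (@filter_forall _ _ (fun i x => 0 < (x *m invmx A) 0 i) (nbhs s)) => i.
    by have := @continuous_mulmx_coord n n (invmx A) i s _ (lt_nbhsr (c0 i)).
  have n1 : \forall x \near s, dot x x < 1.
    by have := @continuous_dot n s _ (lt_nbhsl s1).
  (* The column of the linear form whose sign decides the inequality assumed on E. *)
  pose N := col i0 (invmx A) - d *: (invmx A *m const_mx 1 : 'cV[R]_n).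
  have NE x : (x *m N) 0 0 = (x *m invmx A) 0 i0 - d * \sum_i (x *m invmx A) 0 i.
    rewrite mulmxBr -scalemxAr mulmxA [LHS]mxE [X in _ + X]mxE [X in - X]mxE.
    congr (_ - d * _); rewrite !mxE; apply: eq_bigr => i _; first by rewrite mxE.
    by rewrite [const_mx _ _ _]mxE mulr1.
  have sN : (s *m N) 0 0 < 0 by rewrite NE subr_lt0.
  have nd : \forall x \near s, (x *m N) 0 0 < 0.
    by have := @continuous_mulmx_coord n 1 N 0 s _ (lt_nbhsl sN).
  near=> x; split; first split => /=.
  - by move=> i; apply: ltW; move: i; near: x.
  - by apply: ltW; near: x.
  - move=> /Ed; apply/negP; rewrite -ltNge -subr_lt0 -NE; near: x; exact: nd.
have mC := rmeasurable_cube s e.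
apply: (@lt_le_trans _ _ (rvol (E `|` cube s e))); last first.
  by apply: le_rvol => //; [exact: measurableU|move=> x [/EA//|/sub[]]].
have -> : rvol (E `|` cube s e) = (rvol E + rvol (cube s e))%E.
  apply: measureU => //; apply/seteqP; split => t //= [Et /sub[_]]; exact.
(* Adding the cube increases the volume strictly because E, contained in the unit ball, has finite
   volume. *)
rewrite rvol_cube// lteDl ?lte_fin ?exprn_gt0 ?mulrn_wgt0//.
rewrite ge0_fin_numE ?rvol_ge0//; apply: le_lt_trans (rvol_unit_ball_lty n).
by apply: le_rvol => //; [exact: rmeasurable_unit_ball|move=> x /EA[]].
Unshelve. all: by end_near.
Qed.

End conic_volume.

(** * Comparison of cones through their Gram matrices *)

Section conic_gram.
Context {R : realType}.

(* With l = sqrt (h / (h + w)), the rows of B' = l^-1 (l + (1 - l) e c) A have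
   the same Gram matrix as those of B, so the two cones are isometric. Since c is
   a probability vector, the rows of B' are combinations of those of A with
   nonnegative coefficients. *)
Lemma rvol_conic_gram_lt n (A B : 'M[R]_n) (c : 'rV[R]_n) (h w : R) (i0 i1 : 'I_n) :
  let e : 'cV[R]_n := const_mx 1 in
  A \in unitmx -> i0 != i1 -> (forall i, 0 <= c 0 i) -> 0 < c 0 i0 ->
  c *m e = 1%:M -> A *m A^T *m c^T = h *: e -> 0 < w ->
  B *m B^T = A *m A^T + w *: (e *m e^T) ->
  (rvol (conic B `&` @unit_ball R n) < rvol (conic A `&` @unit_ball R n))%E.
Proof.
move=> e uA i01 c0 ci0 ce Ac w0 BA.
(* [h] is the squared length of [c *m A], the foot of the perpendicular from the apex; it is nonzero
   since A is invertible and c is not 0. *)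
have h0 : 0 < h.
  have cA0 : c *m A != 0.
    apply: contraTneq ci0 => /(congr1 (mulmx^~ (invmx A))).
    by rewrite mulmxK// mul0mx => ->; rewrite mxE ltxx.
  suff <- : dot (c *m A) (c *m A) = h by rewrite dot_gt0.
  by rewrite dotE trmx_mul !mulmxA -mulmxA -mulmxA (mulmxA A) Ac -scalemxAr ce !mxE eqxx mulr1.
have hw0 : 0 < h + w by rewrite addr_gt0.
pose l := Num.sqrt (h / (h + w)).
have l0 : 0 < l by rewrite sqrtr_gt0 divr_gt0.
have l2 : l ^+ 2 = h / (h + w) by rewrite sqr_sqrtr// ltW// divr_gt0.
have l1 : l < 1.
  rewrite -(@ltr_pXn2r _ 2)// ?nnegrE ?ltW// l2 expr1n ltr_pdivrMr// mul1r.
  by rewrite ltrDl.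
have ln0 : l != 0 by rewrite gt_eqF.
(* Acting on the rows of A, M is the contraction of ratio l towards the point [c *m A]. *)
pose M := l%:M + (1 - l) *: (e *m c).
have Me : M *m e = e.
  rewrite mulmxDl mul_scalar_mx -scalemxAl -mulmxA ce mulmx1 -scalerDl.
  by rewrite addrC subrK scale1r.
have uM : M \in unitmx.
  (* Since M fixes e, M (1 - (1 - l) e c) = M - (1 - l) e c = l. *)
  have : M *m (l^-1 *: (1%:M - (1 - l) *: (e *m c))) = 1%:M.
    rewrite -scalemxAr mulmxBr mulmx1 -scalemxAr mulmxA Me /M addrK.
    by rewrite scale_scalar_mx mulVf.
  by case/mulmx1_unit.
pose B' := l^-1 *: (M *m A).
have uB' : B' \in unitmx.
  by rewrite unitmxZ ?unitfE ?invr_eq0// unitmx_mul uM.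
have cA : c *m (A *m A^T) = h *: e^T.
  by rewrite -[LHS]trmxK trmx_mul [(A *m _)^T]trmx_mul (trmxK A) Ac linearZ.
(* After division by l^2 the coefficient of [e *m e^T] is h (1 - l^2) / l^2, and l was chosen to
   make it equal to w. *)
have MGM : M *m (A *m A^T) *m M^T =
    l ^+ 2 *: (A *m A^T) + (h * (1 - l ^+ 2)) *: (e *m e^T).
  have MG : M *m (A *m A^T) = l *: (A *m A^T) + ((1 - l) * h) *: (e *m e^T).
    rewrite mulmxDl mul_scalar_mx; congr (_ + _).
    by rewrite -scalemxAl -mulmxA cA -scalemxAr scalerA.
  have MT : M^T = l%:M + (1 - l) *: (c^T *m e^T).
    by rewrite linearD linearZ/= trmx_mul tr_scalar_mx.
  have ec : e^T *m c^T = 1%:M by rewrite -trmx_mul ce trmx1.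
  rewrite MG MT mulmxDr !mulmxDl mul_mx_scalar -!scalemxAl -!scalemxAr.
  rewrite mul_mx_scalar !mulmxA Ac -(mulmxA e) ec mulmx1 -!scalemxAl.
  rewrite !scalerA -!addrA -!scalerDl; congr (_ *: _ + _ *: _); ring.
have BB : B' *m B'^T = B *m B^T.
  rewrite /B' linearZ/= -scalemxAl -scalemxAr scalerA trmx_mul !mulmxA.
  rewrite -(mulmxA M A) MGM BA scalerDr !scalerA; congr (_ + _ *: _).
    by rewrite (_ : _ * _ = 1) ?scale1r//; field.
  have -> : l^-1 * l^-1 = (h + w) / h by rewrite -invfM -expr2 l2 invf_div.
  by rewrite l2; field; rewrite !gt_eqF.
have uB : B \in unitmx.
  have : B *m B^T \in unitmx by rewrite -BB unitmx_mul unitmx_tr uB'.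
  by rewrite unitmx_mul => /andP[].
(* Equality of the Gram matrices of B and [B'] makes this change of generators orthogonal; it
   carries one cone onto the other. *)
pose O := invmx B *m B'.
have OO : O *m O^T = 1%:M.
  rewrite /O trmx_mul !mulmxA -(mulmxA _ B') BB mulmxA mulVmx// mul1mx.
  by rewrite -trmx_mul mulVmx// trmx1.
have mB' : rmeasurable (conic B' `&` @unit_ball R n).
  by apply: measurableI; [exact: rmeasurable_conic|exact: rmeasurable_unit_ball].
rewrite (_ : rvol (conic B `&` _) = rvol (conic B' `&` @unit_ball R n)); last first.
  rewrite -[RHS](rvol_orthogonal OO)//; congr rvol; apply/seteqP.
  split => x [] /= [a a0 xa] x1.
    split; last by rewrite /unit_ball/= (dot_mul_orthogonal x OO).
    by exists a => //; rewrite xa /O mulmxA mulmxK.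
  split; last by move: x1; rewrite /unit_ball/= (dot_mul_orthogonal x OO).
  exists a => //; move/(congr1 (mulmx^~ (invmx B'))): xa.
  by rewrite /O mulmxA !mulmxK// => <-; rewrite mulmxKV.
have B'A a : a *m B' *m invmx A = a + (l^-1 * (1 - l) * (a *m e) 0 0) *: c.
  have ek : a *m e = ((a *m e) 0 0)%:M by exact: mx11_scalar.
  rewrite -scalemxAr -scalemxAl mulmxA mulmxK// mulmxDr mul_mx_scalar.
  rewrite -scalemxAr mulmxA [in LHS]ek mul_scalar_mx scalerDr.
  by rewrite !scalerA mulVf// scale1r mulrA.
have ae0 (a : 'rV[R]_n) : (forall i, 0 <= a 0 i) -> 0 <= (a *m e) 0 0.
  by move=> a0; rewrite mxE sumr_ge0// => i _; rewrite mxE mulr1.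
(* By [B'A], coefficients a of sum s become A-coordinates of sum s / l, whose [i0]-th one is at
   least (1 - l) (s / l) times that of c. This gives d. *)
apply: (@rvol_conic_lt _ _ A _ i0 i1 ((1 - l) * c 0 i0)) => //.
- by rewrite mulr_gt0// subr_gt0.
- move=> x [[a a0 ->] x1]; split=> //; rewrite conicE//= => i.
  rewrite B'A mxE addr_ge0// mxE !mulr_ge0// ?ae0//; first by rewrite invr_ge0 ltW.
  by rewrite subr_ge0 ltW.
- move=> x [[a a0 ->] _].
  have -> : \sum_i (a *m B' *m invmx A) 0 i = l^-1 * (a *m e) 0 0.
    transitivity ((a *m B' *m invmx A *m e) 0 0).
      by rewrite mxE; apply: eq_bigr => i _; rewrite [e _ _]mxE mulr1.
    rewrite B'A mulmxDl -scalemxAl ce mxE [X in _ + X]mxE [1%:M _ _]mxE eqxx mulr1.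
    by field.
  rewrite B'A [leRHS]mxE [X in _ <= _ + X]mxE -[leLHS]add0r lerD//.
  by rewrite le_eqVlt; apply/orP; left; apply/eqP; ring.
Qed.

End conic_gram.

(* Extending slightly the segment from [U i] to p beyond p stays in the hull,
   which bounds the i-th barycentric coordinate of p below by t / (1 + t). *)
Lemma rel_interior_conv_hull_gt0 (R : realType) (m n : nat)
    (U : 'I_n -> 'rV[R]_m) (p : 'rV[R]_m) (c : 'I_n -> R) (i : 'I_n) :
  (forall a b : 'I_n -> R, \sum_j a j = 1 -> \sum_j b j = 1 ->
    \sum_j a j *: U j = \sum_j b j *: U j -> a =1 b) ->
  rel_interior (aff U) (conv_hull U) p ->
  \sum_j c j = 1 -> p = \sum_j c j *: U j -> 0 < c i.
Proof.
move=> inj [_ pint] c1 pc.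
have [t t0 tU] : exists2 t : R, 0 < t & aff U (p + t *: (p - U i)) ->
    conv_hull U (p + t *: (p - U i)).
  have cvgp : p + t *: (p - U i) @[t --> (0 : R)^'+] --> p.
    suff : p + t *: (p - U i) @[t --> (0 : R)^'+] --> p + 0 *: (p - U i).
      by rewrite scale0r addr0.
    apply: cvg_at_right_filter; apply: cvgD; first exact: cvg_cst.
    by apply: cvgZr_tmp; exact: cvg_id.
  have near_t : \forall t \near (0 : R)^'+,
      aff U (p + t *: (p - U i)) -> conv_hull U (p + t *: (p - U i)).
    exact: cvgp _ pint.
  have [t [tU t0]] := @filter_ex _ _ _ _ (filterI near_t (nbhs_right_gt 0)).
  by exists t.
(* Barycentric coordinates of the extended point; by [inj] they must agree with the nonnegative ones
   given by the hull. *)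
pose d j := (1 + t) * c j - t * (j == i)%:R.
have di1 : \sum_j (j == i)%:R = 1 :> R.
  by rewrite (bigD1 i)//= eqxx big1 ?addr0// => j /negbTE ->.
have d1 : \sum_j d j = 1.
  by rewrite /d sumrB -!mulr_sumr c1 di1; ring.
have dU : p + t *: (p - U i) = \sum_j d j *: U j.
  under eq_bigr do rewrite scalerBl -!scalerA.
  rewrite sumrB -!scaler_sumr -pc (_ : \sum_j (j == i)%:R *: U j = U i).
    by rewrite scalerDl scale1r scalerBr addrA.
  rewrite (bigD1 i)//= eqxx scale1r big1 ?addr0// => j /negbTE ->.
  by rewrite scale0r.
have [|b [b0 b1 bU]] := tU; first by exists d.
have := inj _ _ d1 b1; rewrite -dU -bU => /(_ erefl)/(_ i).
rewrite /d eqxx mulr1 => dbi.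
have := b0 i; rewrite -dbi subr_ge0 => tc.
by rewrite -(pmulr_rgt0 _ (addr_gt0 ltr01 t0)); exact: lt_le_trans tc.
Qed.

(** * Barycentric coordinates and Gram matrices for the two angles *)

Theorem theorem6 (R : realType) (m n : nat) (n_ge2 : (2 <= n)%N)
    (n_le_m : (n <= m)%N) (U : 'I_n -> 'rV[R]_m) (u v p : 'rV[R]_m)
    (u_pos : (0 < angle_norm u U)%E)
    (proj_p : orth_proj (aff U) u p)
    (p_int : rel_interior (aff U) (conv_hull U) p)
    (v_orth : forall i : 'I_n, dot (u - v) (u - U i) = 0)
    (u_neq_v : u <> v) :
  (angle_norm v U < angle_norm u U)%E.
Proof.
pose e : 'cV[R]_n := const_mx 1.
pose a := \matrix_i (U i - u); pose b := \matrix_i (U i - v).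
have [A AA uA] := angle_normE u U n_le_m.
have [B BB vB] := angle_normE v U n_le_m.
have unitA : A \in unitmx.
  by apply: contraTT u_pos => nA; rewrite uA rvol_conic_singular// ltxx.
have sumE (k : 'I_n -> R) : \sum_i k i = 1 ->
    \sum_i k i *: U i = u + (\row_i k i) *m a.
  move=> k1; rewrite mulmx_sum_row.
  under [in RHS]eq_bigr do rewrite mxE rowK scalerBr.
  by rewrite sumrB -scaler_suml k1 scale1r addrC subrK.
(* Affine independence of U: multiplying by [a^T] brings in the Gram matrix of a, which is
   invertible and can be cancelled. *)
have inj (k l : 'I_n -> R) : \sum_i k i = 1 -> \sum_i l i = 1 ->
    \sum_i k i *: U i = \sum_i l i *: U i -> k =1 l.
  move=> k1 l1; rewrite !sumE// => /addrI/(congr1 (mulmx^~ a^T)).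
  have uAA : A *m A^T \in unitmx by rewrite unitmx_mul unitmx_tr unitA.
  rewrite -!mulmxA -AA => /(congr1 (mulmx^~ (invmx (A *m A^T)))).
  by rewrite !mulmxK// => /rowP kl i; have := kl i; rewrite !mxE.
have [k [k0 k1 pk]] : conv_hull U p.
  by have [pU pint] := p_int; exact: nbhs_singleton pint pU.
pose i0 : 'I_n := Ordinal (ltnW n_ge2); pose i1 : 'I_n := Ordinal n_ge2.
pose c := \row_i k i; pose q := p - u.
have qE : c *m a = q by rewrite /q pk sumE// addrC addKr.
have ce : c *m e = 1%:M.
  rewrite [LHS]mx11_scalar mxE; congr (_%:M); rewrite -k1.
  by apply: eq_bigr => i _; rewrite !mxE mulr1.
(* The projection condition, tested at the vertex [U i], says that q is orthogonal to a_i - q. *)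
have aq : a *m q^T = dot q q *: e.
  apply/colP => i; have [_ /(_ (U i))] := proj_p.
  have Ui : aff U (U i).
    exists (fun j => (j == i)%:R).
      by rewrite (bigD1 i)//= eqxx big1 ?addr0// => j /negbTE ->.
    rewrite (bigD1 i)//= eqxx scale1r big1 ?addr0// => j /negbTE ->.
    by rewrite scale0r.
  move=> /(_ Ui); rewrite -(opprB p u) -/q (_ : U i - p = row i a - q); last first.
    by rewrite rowK /q opprB addrA subrK.
  rewrite dotE mulNmx linearB/= mulmxBr mxE => /eqP; rewrite oppr_eq0 mxE.
  rewrite [X in _ + X]mxE subr_eq0 -!dotE => /eqP qa.
  transitivity (dot q (row i a)); last by rewrite qa [RHS]mxE [e _ _]mxE mulr1.
  by rewrite /dot mxE; apply: eq_bigr => j _; rewrite !mxE mulrC.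
pose w := v - u.
have aw : a *m w^T = 0.
  apply/colP => i; rewrite [RHS]mxE -[RHS](v_orth i) [LHS]mxE.
  by apply: eq_bigr => j _; rewrite !mxE; ring.
have bE : b = a - e *m w.
  apply/row_matrixP => i; rewrite linearB/= row_mul !rowK.
  rewrite (_ : row i e = 1%:M) ?mul1mx; last first.
    by apply/rowP => j; rewrite !mxE ord1 eqxx.
  by rewrite /w opprB addrA subrK.
rewrite uA vB.
apply: (@rvol_conic_gram_lt _ _ A B c (dot q q) (dot w w) i0 i1) => //.
- by move=> i; rewrite mxE.
- rewrite mxE; exact: (rel_interior_conv_hull_gt0 i0 inj p_int k1 pk).
- by rewrite AA -mulmxA -trmx_mul qE.
- by rewrite dot_gt0 subr_eq0; apply/eqP => vu; apply: u_neq_v.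
(* Expanding the Gram matrix of b = a - e w, the cross terms vanish since w is orthogonal to the
   rows of a. *)
have bT : b^T = a^T - w^T *m e^T by rewrite bE linearB/= trmx_mul.
have wa : w *m a^T = 0 by rewrite -[LHS]trmxK trmx_mul trmxK aw trmx0.
rewrite BB AA -/a -/b bT bE mulmxBr !mulmxBl mulmxA aw mul0mx -mulmxA wa mulmx0.
rewrite !subr0 sub0r opprK mulmxA -(mulmxA e w) [w *m w^T]mx11_scalar -dotE.
by rewrite mul_mx_scalar scalemxAl.
Qed.
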